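(* Let $m \ge 3$ be odd and $n = 3^m-1$. Then the dual code $\mathcal{C}_{(0,3,m)}^\perp$ has parameters $[n,k,d]$ with $d \ge \frac{3^{(m-1)/2}+15}{2}$ if $m \equiv 1 \pmod 4$ and $d \ge \frac{3^{(m-1)/2}+13}{2}$ if $m \equiv 3 \pmod 4$, and $k = \frac{n-2}{2}$ if $m \equiv 1 \pmod 4$ and $k = \frac{n}{2}$ if $m \equiv 3 \pmod 4$.
   Context: Let $m \ge 2$ be an integer, $n = 3^m-1$, and let $\alpha$ be a primitive element of $\mathbb{F}_{3^m}$. For an integer $0 \le j \le n-1$ with $3$-adic expansion $j = \sum_{t=0}^{m-1} j_t 3^t$, $j_t \in \{0,1,2\}$, let $w_3(j) = \sum_{t=0}^{m-1} j_t$. For distinct $i_1, i_2 \in \{0,1,2,3\}$ let $T_{(i_1,i_2,m)} = \{1 \le j \le n-1 : w_3(j) \equiv i_1 \text{ or } i_2 \pmod 4\}$ and $g_{(i_1,i_2,m)}(x) = \prod_{j \in T_{(i_1,i_2,m)}} (x - \alpha^j) \in \mathbb{F}_3[x]$. $\mathcal{C}_{(i_1,i_2,m)}$ denotes the ternary cyclic code of length $n$ with generator polynomial $g_{(i_1,i_2,m)}(x)$, and $\mathcal{C}^\perp$ denotes the dual code with respect to the standard inner product on $\mathbb{F}_3^n$. Parameters $[n,k,d]$ mean length, dimension over $\mathbb{F}_3$, and minimum Hamming distance. *)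

(* Defs.v *)
From HB Require Import structures.
From mathcomp Require Import all_boot all_order all_algebra.
Set Implicit Arguments. Unset Strict Implicit. Unset Printing Implicit Defensive.
Import GRing.Theory.
Local Open Scope ring_scope.

Definition w3 (m j : nat) : nat := (\sum_(t < m) ((j %/ 3 ^ t) %% 3))%N.

Definition Tset (i1 i2 m : nat) : seq nat :=
  [seq j <- iota 1 (3 ^ m - 2) | (w3 m j %% 4 == i1 %% 4)%N || (w3 m j %% 4 == i2 %% 4)%N].

(* g_(i1,i2,m)(x) = prod_{j in T} (x - alpha^j), computed in F[x]
   where F = GF(3^m); its coefficients lie in F_3. *)
Definition gen_poly (F : fieldType) (alpha : F) (i1 i2 m : nat) : {poly F} :=
  \prod_(j <- Tset i1 i2 m) ('X - (alpha ^+ j)%:P).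

(* the canonical embedding F_3 -> F (F of characteristic 3) *)
Definition emb3 (F : fieldType) (a : 'F_3) : F := (nat_of_ord a)%:R.

Definition word_poly (F : fieldType) (n : nat) (c : 'rV['F_3]_n) : {poly F} :=
  \sum_(i < n) emb3 F (c ord0 i) *: 'X^i.

Definition cyc_code (F : fieldType) (alpha : F) (i1 i2 m : nat)
  : {set 'rV['F_3]_(3 ^ m - 1)} :=
  [set c | gen_poly alpha i1 i2 m %| word_poly F c].

Definition dotF3 (n : nat) (u v : 'rV['F_3]_n) : 'F_3 := \sum_(i < n) u ord0 i * v ord0 i.

Definition dual_code (n : nat) (C : {set 'rV['F_3]_n}) : {set 'rV['F_3]_n} :=
  [set v | [forall c in C, dotF3 v c == 0]].

Definition code_dim (n : nat) (C : {set 'rV['F_3]_n}) : nat :=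
  \dim (<< enum C >>%VS).

Definition wt (n : nat) (c : 'rV['F_3]_n) : nat := #|[set i : 'I_n | c ord0 i != 0]|.

(* Main.v *)
Require Import Defs.
From HB Require Import structures.
From mathcomp Require Import all_boot all_order all_algebra all_field.
From mathcomp Require Import zify ring.
Set Implicit Arguments. Unset Strict Implicit. Unset Printing Implicit Defensive.
Import GRing.Theory.
Local Open Scope ring_scope.

(** Write m = 2h + 1 and n = 3^m - 1 = 2N.  Since the digit sum of n - j is
    2m - w3(j), the dual code consists of the words whose polynomial f vanishes
    at alpha^j for all j < n with w3(j) = 0, 1 mod 4; its dimension |T| is found
    from a two-step recurrence for the number of j with prescribed w3(j) mod 4.

    Let g be the even one of h, h + 1.  Then w3(a (3^g - 1)) = 2g = 0 mod 4 for
    1 <= a <= 3^h, and w3(3^(2h) + a (3^g - 1)) = 2g + 1 for 1 <= a <= 2 3^(h-1).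
    As gcd(3^g - 1, n) = 2, the BCH argument does not apply to a codeword c
    itself but to its folding c_i + c_(i+N) of length N.  If the folding is
    nonzero, the even exponents give weight at least 3^h + 2.  Otherwise
    c_(i+N) = - c_i, and the odd exponents give weight at least
    2 (2 3^(h-1) + 2).  This suffices for h >= 3, and also for h = 2, where
    a = 3^h + 1 is one more admissible even exponent.

    For h = 1 (length 26) the van Lint-Wilson shifting bound gives weight 8. *)

(** * Ternary digit sums *)

Section Digits.
Local Open Scope nat_scope.

Lemma w3S m j : w3 m.+1 j = j %% 3 + w3 m (j %/ 3).
Proof.
rewrite /w3 big_ord_recl expn0 divn1; congr addn.
by apply: eq_bigr => i _; rewrite /= /bump /= add1n expnS divnMA.
Qed.

Lemma w3_cat k l x y : x < 3 ^ k -> w3 (k + l) (x + 3 ^ k * y) = w3 k x + w3 l y.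
Proof.
elim: k x => [|k IHk] x.
  by rewrite expn0 ltnS leqn0 mul1n => /eqP ->; rewrite /(w3 0) big_ord0.
rewrite expnS => lt_x; rewrite addSn !w3S -mulnA [3 * _]mulnC [x + _]addnC.
rewrite divnMDl // modnMDl -addnA -IHk; first by rewrite [_ %/ 3 + _]addnC.
by rewrite ltn_divLR // mulnC.
Qed.

Lemma w3_0 k : w3 k 0 = 0.
Proof. by elim: k => [|k IHk]; [rewrite /w3 big_ord0 | rewrite w3S div0n IHk]. Qed.

Lemma w3_widen k l x : x < 3 ^ k -> w3 (k + l) x = w3 k x.
Proof. by move=> lt_x; rewrite -[x in LHS]addn0 -(muln0 (3 ^ k)) w3_cat // w3_0 addn0. Qed.

Lemma w3_digit k x : x < 3 -> w3 k.+1 x = x.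
Proof. by move=> lt_x; rewrite w3S modn_small // divn_small // w3_0 addn0. Qed.

(** Subtraction from a string of digits 2 never borrows: each digit [d] becomes [2 - d]. *)
Lemma w3_compl k b : b < 3 ^ k -> w3 k (3 ^ k - 1 - b) = 2 * k - w3 k b.
Proof.
suff H : b < 3 ^ k -> w3 k (3 ^ k - 1 - b) + w3 k b = 2 * k by move=> /H; lia.
elim: k b => [|k IHk] b; first by rewrite /w3 !big_ord0.
rewrite expnS => lt_b; rewrite !w3S.
have lt_q : b %/ 3 < 3 ^ k by rewrite ltn_divLR // mulnC.
have e1 : (3 * 3 ^ k - 1 - b) %/ 3 = 3 ^ k - 1 - b %/ 3 by lia.
have e2 : (3 * 3 ^ k - 1 - b) %% 3 = 2 - b %% 3 by lia.
rewrite e1 e2; have := IHk _ lt_q; lia.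
Qed.

Lemma w3_le k b : w3 k b <= 2 * k.
Proof.
rewrite /w3 mulnC -[k in k * 2]card_ord -sum_nat_const.
by apply: leq_sum => i _; rewrite -ltnS ltn_mod.
Qed.

(** Tripling modulo 3^m - 1 rotates the m digits cyclically, the leading one wrapping round to the
    units place. *)
Lemma w3_rotate m j : 0 < m -> j < 3 ^ m - 1 -> w3 m ((3 * j) %% (3 ^ m - 1)) = w3 m j.
Proof.
case: m => // m _ lt_j; rewrite (divn_eq j (3 ^ m)).
set d := j %/ _; set r := j %% _.
have p0 : 0 < 3 ^ m by rewrite expn_gt0.
have lt_r : r < 3 ^ m by rewrite ltn_mod.
have lt_d : d < 3 by rewrite ltn_divLR //; rewrite expnS in lt_j; lia.
have -> : 3 * (d * 3 ^ m + r) = d * (3 ^ m.+1 - 1) + (d + 3 * r).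
  by rewrite expnS; case: (d) lt_d => [|[|[|]]] // _; lia.
have djr : j = d * 3 ^ m + r by rewrite /d /r -divn_eq.
rewrite modnMDl modn_small; last first.
  move: lt_j; rewrite djr expnS => {}lt_j.
  by case: (d) lt_d lt_j => [|[|[|]]] // _; lia.
have -> : d + 3 * r = r * 3 + d by lia.
rewrite w3S modnMDl divnMDl // modn_small // [d %/ 3]divn_small // addn0.
by rewrite -[m.+1]addn1 [_ * _ + _]addnC [d * _]mulnC w3_cat // (w3_digit 0) // addnC.
Qed.

Lemma mul_pred_split b q : b < q -> b.+1 * (q - 1) = (q - 1 - b) + q * b.
Proof. by move=> lt_b; rewrite -(subnKC lt_b); move: (q - b.+1) => k; rewrite addSn subn1 /= addKn; lia. Qed.

(* a (3^g - 1) = (a - 1) 3^g + (3^g - 1 - (a - 1)): the low digits complement the high ones. *)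
Lemma w3_multiple m g b : g <= m -> b < 3 ^ g -> b < 3 ^ (m - g) ->
  w3 m (b.+1 * (3 ^ g - 1)) = 2 * g.
Proof.
move=> le_gm lt_bg lt_bm.
have p0 : 0 < 3 ^ g by rewrite expn_gt0.
have -> : b.+1 * (3 ^ g - 1) = (3 ^ g - 1 - b) + 3 ^ g * b by apply: mul_pred_split.
rewrite -{1}(subnKC le_gm) w3_cat; last by lia.
rewrite w3_compl //; have := w3_le g b.
suff -> : w3 (m - g) b = w3 g b by lia.
by rewrite -(w3_widen g lt_bm) addnC w3_widen.
Qed.

(** The quotient of b by 3^k is 0 or 1, so adding 3^k raises digit k to at most 2, without a
    carry. *)
Lemma w3_add_pow M k b : k < M -> b < 2 * 3 ^ k -> w3 M (b + 3 ^ k) = (w3 M b).+1.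
Proof.
move=> lt_kM lt_b; have p0 : 0 < 3 ^ k by rewrite expn_gt0.
have lt_q : b %/ 3 ^ k < 2 by rewrite ltn_divLR.
rewrite {1 2}(divn_eq b (3 ^ k)).
have -> : b %/ 3 ^ k * 3 ^ k + b %% 3 ^ k + 3 ^ k = b %% 3 ^ k + 3 ^ k * (b %/ 3 ^ k).+1 by lia.
rewrite [X in _ = (w3 _ X).+1]addnC [_ * 3 ^ k]mulnC.
rewrite -(subnKC (ltnW lt_kM)) !w3_cat ?ltn_mod //.
have -> : M - k = (M - k).-1.+1 by lia.
by rewrite !w3_digit; lia.
Qed.

(** As in [w3_multiple], the low g digits complement b; above them stands b + 3^(2h-g), carry-free
    by [w3_add_pow]. The bound on b is the one that g = h + 1 demands. *)
Lemma w3_multiple_shift h g b : 0 < h -> g = h \/ g = h.+1 -> b < 2 * 3 ^ h.-1 ->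
  w3 (2 * h).+1 (3 ^ (2 * h) + b.+1 * (3 ^ g - 1)) = (2 * g).+1.
Proof.
move=> h0 hg lt_b.
have p0 : 0 < 3 ^ g by rewrite expn_gt0.
have E : 3 ^ h = 3 * 3 ^ h.-1 by rewrite -expnS prednK.
have Eg : 3 ^ (2 * h) = 3 ^ g * 3 ^ (2 * h - g) by rewrite -expnD; congr expn; lia.
have lt_bg : b < 3 ^ g.
  by move: lt_b; case: hg => ->; rewrite ?expnS E; move: (3 ^ h.-1); clear; lia.
have lt_b2 : b < 2 * 3 ^ (2 * h - g).
  case: hg => ->; first by have -> : 2 * h - h = h; [lia | move: lt_b; rewrite E; clear; lia].
  by have -> : 2 * h - h.+1 = h.-1 by lia.
have lt_bm : b < 3 ^ ((2 * h).+1 - g).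
  have {}lt_b : b < 3 ^ h by move: lt_b; rewrite E; clear; lia.
  case: hg => ->; last by have -> : (2 * h).+1 - h.+1 = h by lia.
  by have -> : (2 * h).+1 - h = h.+1; [lia | rewrite expnS; move: lt_b; clear; lia].
rewrite Eg.
have -> : 3 ^ g * 3 ^ (2 * h - g) + b.+1 * (3 ^ g - 1)
   = (3 ^ g - 1 - b) + 3 ^ g * (b + 3 ^ (2 * h - g)).
  by rewrite mul_pred_split // mulnDr addnC addnA.
have le_g : g <= (2 * h).+1 by lia.
rewrite -{1}(subnKC le_g) w3_cat; last by lia.
rewrite w3_add_pow //; last by lia.
rewrite w3_compl //; have := w3_le g b.
suff -> : w3 ((2 * h).+1 - g) b = w3 g b by lia.
by rewrite -(w3_widen g lt_bm) addnC w3_widen.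
Qed.

(** * Counting exponents by digit sum modulo 4 *)

Lemma w3_top m d r : d < 3 -> r < 3 ^ m -> w3 m.+1 (r + d * 3 ^ m) = d + w3 m r.
Proof.
by move=> lt_d lt_r; rewrite mulnC -addn1 w3_cat // (w3_digit 0) // addnC.
Qed.

(** The range splits by the leading digit. An arbitrary [f] lets the lemma be applied twice in a
    row. *)
Lemma sum_w3S (f : nat -> nat) m :
  \sum_(0 <= j < 3 ^ m.+1) f (w3 m.+1 j) =
  \sum_(0 <= j < 3 ^ m) (f (w3 m j) + f (w3 m j).+1 + f (w3 m j).+2).
Proof.
have step d : d < 3 -> \sum_(d * 3 ^ m <= j < d.+1 * 3 ^ m) f (w3 m.+1 j)
    = \sum_(0 <= j < 3 ^ m) f (d + w3 m j).
  move=> lt_d; rewrite -{1}[d * 3 ^ m]add0n big_addn.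
  have -> : d.+1 * 3 ^ m - d * 3 ^ m = 3 ^ m by lia.
  by apply: eq_big_nat => j /andP[_ lt_j]; rewrite w3_top.
rewrite (big_cat_nat (n := 1 * 3 ^ m)) //=; last by rewrite expnS; lia.
rewrite (big_cat_nat (n := 2 * 3 ^ m) (m := 1 * 3 ^ m)) //=; rewrite ?expnS; try lia.
rewrite -{1}[0](mul0n (3 ^ m)) !step // !big_split /= addnA.
by congr (_ + _ + _).
Qed.

(** The unreduced residues copy the filter of [Tset], so that both match after unfolding. *)
Definition in_T03 (w : nat) : bool := (w %% 4 == 0 %% 4) || (w %% 4 == 3 %% 4).

(** Two more digits add 0, 1, 2, 3, 4 with multiplicities 1, 2, 3, 2, 1. With the extra term, the
    offsets 0, 1, 2, 3 modulo 4 get weights 3, 2, 3, 2. Exactly one of w, w + 2 is 0 or 3 modulo 4,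
    and likewise for w + 1, w + 3; hence 3 + 2 = 5. *)
Lemma sum_in_T03_step m :
  \sum_(0 <= j < 3 ^ m.+2) in_T03 (w3 m.+2 j) + \sum_(0 <= j < 3 ^ m) in_T03 (w3 m j)
  = 5 * 3 ^ m.
Proof.
pose f w : nat := in_T03 w.
rewrite (sum_w3S f) (sum_w3S (fun w => f w + f w.+1 + f w.+2)) -big_split /=.
rewrite (eq_bigr (fun=> 5)); first by rewrite sum_nat_const_nat subn0 mulnC.
move=> j _; rewrite /f /in_T03; move: (w3 m j) => w.
have : w %% 4 < 4 by rewrite ltn_mod.
have aux k : (w + k) %% 4 = (w %% 4 + k) %% 4 by rewrite modnDml.
rewrite -!(addn1 w) -?addnS !aux.
by move: (w %% 4) => -[|[|[|[|]]]].
Qed.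

(** If twice the count is P - e for P = 3^m and e = 1 or -1, the recurrence gives 10 P - (P - e) = 9
    P + e: the sign alternates along with m modulo 4. *)
Lemma sum_in_T03 m : odd m ->
  2 * \sum_(0 <= j < 3 ^ m) in_T03 (w3 m j) = if m %% 4 == 1 then 3 ^ m - 1 else 3 ^ m + 1.
Proof.
move=> om; rewrite -(odd_double_half m) om add1n.
elim: m./2 => [|k IHk].
  by rewrite /= expn1 (sum_w3S in_T03 0) expn0 big_nat1 /w3 !big_ord0.
rewrite doubleS; have := sum_in_T03_step k.*2.+1; move: IHk.
have p0 : 0 < 3 ^ k.*2.+1 by rewrite expn_gt0.
set x := \sum_(0 <= j < 3 ^ k.*2.+1) _; set y := \sum_(0 <= j < 3 ^ k.*2.+3) _.
rewrite [3 ^ k.*2.+3]expnS [3 ^ k.*2.+2]expnS.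
move: x y (3 ^ _) p0 => x y P p0.
have -> : (k.*2.+3 %% 4 == 1) = ~~ (k.*2.+1 %% 4 == 1) by lia.
by case: eqP => _ /=; lia.
Qed.

(** The full count includes j = 0 but not j = 3^m - 1, whose digit sum 2m is 2 modulo 4; so it
    exceeds |T| by one. *)
Lemma size_Tset03 m : 1 < m -> odd m ->
  2 * size (Tset 0 3 m) = if m %% 4 == 1 then 3 ^ m - 1 - 2 else 3 ^ m - 1.
Proof.
move=> m1 om; have := sum_in_T03 om.
have p0 : 3 ^ 2 <= 3 ^ m by rewrite leq_pexp2l.
have E3 : 3 ^ m = (3 ^ m - 2).+2 by lia.
rewrite [X in \sum_(_ <= _ < X) _]E3 big_nat_recr //= big_nat_recl //= w3_0.
have -> : (3 ^ m - 2).+1 = 3 ^ m - 1 - 0 by lia.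
rewrite w3_compl ?w3_0 ?subn0; last by lia.
have -> : in_T03 (2 * m) = false by rewrite /in_T03; lia.
have -> : size (Tset 0 3 m) = \sum_(0 <= i < 3 ^ m - 2) in_T03 (w3 m i.+1).
  rewrite /Tset size_filter -sum1_count big_mkcond /=.
  transitivity (\sum_(1 <= i < (3 ^ m - 2).+1) in_T03 (w3 m i)); last by rewrite big_add1.
  by rewrite /index_iota subn1 /=; apply: eq_bigr => j _; rewrite /in_T03; case: ifP.
have -> : in_T03 0 = true by [].
by case: eqP => _ /=; lia.
Qed.

End Digits.

(** * The BCH bound and folding *)

Section Bounds.
Variable F : fieldType.

(** If the support had at most L points, a polynomial of degree below L vanishing at all of them but
    one would contradict the vanishing power sums. *)
Lemma bch_bound (I : finType) (c x : I -> F) (L : nat) :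
  {in [pred i | c i != 0] &, injective x} ->
  (forall k, (k < L)%N -> \sum_i c i * x i ^+ k = 0) ->
  (exists i, c i != 0) -> (L < #|[set i | c i != 0%R]|)%N.
Proof.
move=> x_inj c_zero [i0 ci0]; rewrite ltnNge; apply/negP => le_L.
set A := [set i | c i != 0] in le_L.
have Ai0 : i0 \in A by rewrite inE.
pose P := \prod_(i in A :\ i0) ('X - (x i)%:P).
have sP : (size P <= L)%N.
  rewrite /P -big_enum /= size_prod_XsubC -cardE.
  by apply: leq_trans le_L; rewrite (cardsD1 i0 A) Ai0 add1n.
have : \sum_i c i * P.[x i] = 0.
  transitivity (\sum_(k < L) P`_k * \sum_i c i * x i ^+ k).
    under [RHS]eq_bigr do rewrite mulr_sumr; rewrite exchange_big /=.
    apply: eq_bigr => i _; rewrite (horner_coef_wide _ sP) mulr_sumr.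
    by apply: eq_bigr => k _; rewrite mulrCA.
  by rewrite big1 // => k _; rewrite c_zero // mulr0.
rewrite (bigD1 i0) //= big1 ?addr0 => [|i neq_i].
  move/eqP; rewrite mulf_eq0 (negPf ci0) /= /P horner_prod prodf_seq_eq0.
  case/hasP => i _ /andP[]; rewrite !inE => /andP[neq_i ci].
  rewrite !hornerE subr_eq0 => /eqP /x_inj e; move: neq_i.
  by rewrite e ?eqxx // inE.
have [->|ci] := eqVneq (c i) 0; first by rewrite mul0r.
rewrite /P horner_prod (bigD1 i) ?inE ?neq_i ?ci //= !hornerE subrr.
by rewrite /= mulr0 mul0r.
Qed.

(** A sum rather than a cardinality, so that folding can split the range into halves. *)
Definition hweight (n : nat) (f : {poly F}) : nat := (\sum_(i < n) (f`_i != 0)%R)%N.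

Lemma hweightE n f : hweight n f = #|[set i : 'I_n | f`_i != 0]|.
Proof. by rewrite /hweight -sum1dep_card [RHS]big_mkcond; apply: eq_bigr => i _; case: ifP. Qed.

Lemma poly_neq0_coef n (f : {poly F}) :
  (size f <= n)%N -> f != 0 -> exists i : 'I_n, f`_i != 0.
Proof.
move=> sf f0; have lt_f : ((size f).-1 < n)%N.
  by apply: leq_trans sf; rewrite ltn_predL lt0n size_poly_eq0.
by exists (Ordinal lt_f); rewrite /= -lead_coefE lead_coef_eq0.
Qed.

Lemma primitive_root_neq0 n (alpha : F) : n.-primitive_root alpha -> alpha != 0.
Proof.
move=> prim; apply/eqP => a0; have := prim_expr_order prim.
by rewrite a0 expr0n gtn_eqF ?(prim_order_gt0 prim) //= => /esym/eqP; rewrite oner_eq0.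
Qed.

(** Twisting coefficient i by alpha^(i s) keeps the support and moves the start of the run of zeros
    to 0. *)
Lemma horner_bch n (alpha : F) (f : {poly F}) s L :
  n.-primitive_root alpha -> (size f <= n)%N -> f != 0 ->
  (forall a, (a < L)%N -> f.[alpha ^+ (s + a)] = 0) -> (L < hweight n f)%N.
Proof.
move=> prim sf f0 zf; have a0 := primitive_root_neq0 prim.
have aX k : alpha ^+ k != 0 by rewrite expf_neq0.
rewrite hweightE.
have -> : [set i : 'I_n | f`_i != 0] = [set i : 'I_n | f`_i * alpha ^+ (i * s) != 0].
  by apply/setP => i; rewrite !inE mulf_eq0 negb_or aX andbT.
apply: (bch_bound (x := fun i : 'I_n => alpha ^+ i)).
- move=> i j _ _ /eqP; rewrite (eq_prim_root_expr prim) !modn_small // => /eqP.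
  exact: val_inj.
- move=> k lt_k; rewrite -[RHS](zf k lt_k) (horner_coef_wide _ sf).
  by apply: eq_bigr => i _; rewrite -mulrA -!exprM -exprD -mulnDr [in RHS]mulnC.
- have [i fi] := poly_neq0_coef sf f0.
  by exists i; rewrite mulf_neq0.
Qed.

Section Folding.
Variables (N : nat) (alpha : F) (f : {poly F}).
Hypotheses (prim : (N + N).-primitive_root alpha) (sf : (size f <= N + N)%N).

Lemma prim_half : alpha ^+ N = -1.
Proof.
have N0 : (0 < N)%N by have := prim_order_gt0 prim; lia.
have /eqP := prim_expr_order prim; rewrite exprD -expr2 sqrf_eq1 => /orP[/eqP aN|/eqP //].
have := prim_order_dvd prim N; rewrite aN eqxx => /(dvdn_leq N0); lia.
Qed.

Lemma two_neq0 : 2%:R != 0 :> F.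
Proof.
have N0 : (0 < N)%N by have := prim_order_gt0 prim; lia.
apply/eqP => e2; have := prim_order_dvd prim N.
rewrite prim_half -subr_eq0 -opprD -mulr2n e2 oppr0 eqxx => /(dvdn_leq N0); lia.
Qed.

(** Since alpha^N = -1, even j see the sums of opposite coefficients and odd j the differences. *)
Lemma horner_fold j :
  f.[alpha ^+ j] = \sum_(i < N) (f`_i + (-1) ^+ j * f`_(N + i)) * alpha ^+ (i * j).
Proof.
rewrite (horner_coef_wide _ sf) big_split_ord /= -big_split /=.
apply: eq_bigr => i _; rewrite mulrDl -!exprM mulnC; congr (_ + _).
by rewrite mulnDr exprD mulnC exprM prim_half [(j * i)%N]mulnC mulrCA mulrA.
Qed.

(** alpha^2 has order N and u is prime to N, so alpha^(2u) still separates the indices below N. *)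
Lemma bch_fold u L (c : nat -> F) : coprime u N ->
  (forall a, (a < L)%N -> \sum_(i < N) c i * alpha ^+ (i * (2 * u * a)) = 0) ->
  (exists i : 'I_N, c i != 0) -> (L < \sum_(i < N) (c i != 0%R))%N.
Proof.
move=> co_u zc exc.
have -> : (\sum_(i < N) (c i != 0%R) = #|[set i : 'I_N | c i != 0%R]|)%N.
  by rewrite -sum1dep_card [RHS]big_mkcond; apply: eq_bigr => i _; case: ifP.
apply: (bch_bound (x := fun i : 'I_N => alpha ^+ (i * (2 * u)))) => //; last first.
  by move=> k /zc zk; rewrite -[RHS]zk; apply: eq_bigr => i _; rewrite -exprM -mulnA.
move=> i j _ _ /eqP; rewrite (eq_prim_root_expr prim) addnn -mul2n.
rewrite ![(_ * (2 * u))%N]mulnCA -!muln_modr eqn_pmul2l // => e; apply: val_inj => /=.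
wlog le_ij : i j e / (i <= j)%N.
  by move=> W; case: (leqP i j) => [|/ltnW] le; [apply: W | apply/esym/W; rewrite // eq_sym].
move: e; rewrite eq_sym eqn_mod_dvd ?leq_mul2r ?le_ij ?orbT // -mulnBl.
rewrite Gauss_dvdl 1?coprime_sym // => dv.
have := ltn_ord j; case: (posnP (j - i)) => [|p]; first by lia.
by have := dvdn_leq p dv; lia.
Qed.

(* The first alternative is f`_i + f`_(N + i) not identically 0, the second one
   f`_(N + i) = - f`_i. *)
Lemma fold_bound u s L L' : coprime u N -> odd s -> f != 0 ->
  (forall a, (a < L)%N -> f.[alpha ^+ (2 * u * a)] = 0) ->
  (forall a, (a < L')%N -> f.[alpha ^+ (s + 2 * u * a)] = 0) ->
  (L < hweight (N + N) f)%N \/ (2 * L'.+1 <= hweight (N + N) f)%N.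
Proof.
move=> co_u odd_s f0 ze zo; rewrite /hweight big_split_ord /= -big_split /=.
have aX k : alpha ^+ k != 0 by rewrite expf_neq0 ?(primitive_root_neq0 prim).
case: (altP (@forallP _ (fun i : 'I_N => f`_i + f`_(N + i) == 0))) => [p0|]; last first.
  move=> /forallPn[i0 pi0]; left.
  apply: leq_trans (_ : \sum_(i < N) (f`_i + f`_(N + i) != 0)%R <= _)%N.
    apply: (bch_fold (c := fun i => f`_i + f`_(N + i)) co_u); last by exists i0.
    move=> a /ze za; rewrite -[RHS]za horner_fold; apply: eq_bigr => i _.
    by rewrite -signr_odd -mulnA oddM /= mul1r.
  apply: leq_sum => i _.
  have [->|_] := eqVneq f`_i 0; last by case: (_ == _).
  by rewrite add0r.
right; have opp i : (i < N)%N -> f`_(N + i) = - f`_i.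
  by move=> lt_i; have := p0 (Ordinal lt_i); rewrite addrC addr_eq0 => /eqP.
(* Here 2 f_i is the difference f_i - f_(N+i), and alpha^(i s) absorbs the offset s; both factors
   are nonzero, so the support is unchanged. *)
have -> : (\sum_(i < N) ((f`_i != 0)%R + (f`_(N + i) != 0)%R) =
           2 * \sum_(i < N) (f`_i *+ 2 * alpha ^+ (i * s) != 0)%R)%N.
  rewrite big_distrr; apply: eq_bigr => i _; rewrite opp // oppr_eq0 /= mul2n -addnn.
  by rewrite mulf_eq0 negb_or aX andbT -mulr_natr mulf_eq0 negb_or two_neq0 andbT.
rewrite leq_mul2l /=.
apply: (bch_fold (c := fun i => f`_i *+ 2 * alpha ^+ (i * s)) co_u).
  move=> a /zo za; rewrite -[RHS]za horner_fold; apply: eq_bigr => i _.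
  rewrite -signr_odd oddD odd_s -mulnA oddM /= expr1 opp // mulrNN mul1r -mulr2n.
  by rewrite -mulrA -exprD -mulnDr.
have [i] := poly_neq0_coef sf f0; rewrite -(splitK i); case: (split i) => k /= fk.
  by exists k; rewrite mulf_neq0 ?aX // -mulr_natr mulf_neq0 ?two_neq0.
exists k; rewrite mulf_neq0 ?aX // -mulr_natr mulf_neq0 ?two_neq0 //.
by move: fk; rewrite opp // oppr_eq0.
Qed.
End Folding.
End Bounds.

(** * The shifting bound *)

Section Shifting.
Variables (F : fieldType) (n : nat) (alpha : F) (f : {poly F}).
Hypotheses (prim : n.-primitive_root alpha) (sf : (size f <= n)%N).

(* The monomials X^a, a in A, are linearly independent on the support of f. *)
Definition free_exps (A : seq nat) : Prop :=
  forall p : nat -> F,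
    (forall i : 'I_n, f`_i != 0 -> \sum_(a <- A) p a * alpha ^+ (i * a) = 0) ->
  {in A, forall a, p a = 0}.

Lemma free_exps_nil : free_exps [::].
Proof. by []. Qed.

(** Pairing a relation with the coefficients of f kills the terms from A and leaves p(b) f(alpha^b),
    so p(b) = 0. *)
Lemma free_exps_cons b A : free_exps A ->
  {in A, forall a, f.[alpha ^+ a] = 0} -> f.[alpha ^+ b] != 0 -> free_exps (b :: A).
Proof.
move=> freeA zA nzb p zp.
have hE a : f.[alpha ^+ a] = \sum_(i < n) f`_i * alpha ^+ (i * a).
  by rewrite (horner_coef_wide _ sf); apply: eq_bigr => i _; rewrite -exprM mulnC.
have pb0 : p b = 0.
  have : \sum_(i < n) f`_i * (\sum_(a <- b :: A) p a * alpha ^+ (i * a)) = 0.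
    rewrite big1 // => i _; have [->|fi] := eqVneq f`_i 0; first by rewrite mul0r.
    by rewrite zp ?mulr0.
  under eq_bigr do rewrite mulr_sumr.
  rewrite exchange_big /=.
  under eq_bigr => a _.
    under eq_bigr do rewrite mulrCA.
    rewrite -mulr_sumr -hE.
    over.
  rewrite big_cons big_seq big1 ?addr0 => [|a /zA ->]; last by rewrite mulr0.
  by move/eqP; rewrite mulf_eq0 (negPf nzb) orbF => /eqP.
move=> a; rewrite inE => /predU1P[-> //|]; apply: freeA => i fi.
by have := zp i fi; rewrite big_cons pb0 mul0r add0r.
Qed.

(** Multiplying by X^t scales the value at each support point by a nonzero factor. *)
Lemma free_exps_shift t A : free_exps A -> free_exps [seq (a + t) %% n | a <- A]%N.
Proof.
move=> freeA p zp.
suff H : {in A, forall a, p ((a + t) %% n)%N = 0} by move=> _ /mapP[a /H pa ->].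
apply: (freeA (fun a => p ((a + t) %% n)%N)) => i /zp; rewrite big_map => zi.
have nz : alpha ^+ (i * t) != 0 by rewrite expf_neq0 ?(primitive_root_neq0 prim).
apply: (mulIf nz); rewrite mul0r mulr_suml -[RHS]zi; apply: eq_bigr => a _.
rewrite -mulrA -exprD -mulnDr; congr (_ * _).
by rewrite mulnC exprM [in RHS]mulnC exprM (prim_expr_mod prim).
Qed.

(** The matrix of the alpha^(i a), a in A and i in the support, has independent rows, hence at least
    as many columns. *)
Lemma free_exps_le A : uniq A -> free_exps A -> (size A <= hweight n f)%N.
Proof.
move=> uA freeA; rewrite hweightE; set S := [set i : 'I_n | _].
pose M : 'M[F]_(size A, #|S|) := \matrix_(k, l) alpha ^+ ((enum_val l : 'I_n) * nth 0%N A k).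
suff /eqP <- : row_free M by apply: rank_leq_col.
apply: inj_row_free => v vM; apply/rowP => k; rewrite mxE.
(* Freeness speaks of functions of the exponent, [v] of positions; [uniq A] makes the position
   recoverable. *)
pose p a := if insub (index a A) is Some k' then v 0 k' else 0.
have pE (j : 'I_(size A)) : p (nth 0%N A j) = v 0 j.
  by rewrite /p index_uniq // valK.
rewrite -pE; apply: freeA; last exact: mem_nth.
move=> i fi; have Si : i \in S by rewrite inE.
have /rowP/(_ (enum_rank_in Si i)) := vM; rewrite !mxE => vE; rewrite -[RHS]vE.
rewrite (big_nth 0%N) big_mkord; apply: eq_bigr => j _.
by rewrite pE mxE enum_rankK_in.
Qed.

End Shifting.

(** * Cyclic codes and their duals *)

Section CharacteristicThree.
Variables (F : fieldType).
Hypothesis ch3 : 3%N \in [pchar F].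

Lemma natr_mod3 k : (k %% 3)%:R = k%:R :> F.
Proof. by rewrite [in RHS](divn_eq k 3) natrD natrM (pcharf0 ch3) mulr0 add0r. Qed.

Lemma emb3D : {morph emb3 F : a b / a + b}.
Proof. by move=> a b; rewrite /emb3 -natrD -[RHS]natr_mod3. Qed.

Lemma emb3M : {morph emb3 F : a b / a * b}.
Proof. by move=> a b; rewrite /emb3 -natrM -[RHS]natr_mod3. Qed.

Lemma emb3_0 : emb3 F 0 = 0. Proof. by []. Qed.

Lemma emb3_eq0 a : (emb3 F a == 0) = (a == 0).
Proof.
apply/idP/eqP => [|->]; last exact: eqxx.
rewrite /emb3 -(dvdn_pcharf ch3) => dv; apply: val_inj => /=.
move: a dv; rewrite /= => -[[|[|[|k]]] //].
Qed.

Lemma emb3_sum I (r : seq I) (P : pred I) (c : I -> 'F_3) :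
  emb3 F (\sum_(i <- r | P i) c i) = \sum_(i <- r | P i) emb3 F (c i).
Proof. exact: (big_morph _ emb3D emb3_0). Qed.

Lemma emb3_cube a : emb3 F a ^+ 3 = emb3 F a.
Proof.
have := pFrobenius_aut_nat ch3 a; rewrite pFrobenius_autE; exact.
Qed.

(** Inverse of [emb3] on the prime field, with default 0 elsewhere. *)
Definition unemb3 (x : F) : 'F_3 := odflt 0 [pick a | emb3 F a == x].

Lemma unemb3K x : x ^+ 3 = x -> emb3 F (unemb3 x) = x.
Proof.
move=> x3; rewrite /unemb3; case: pickP => [a /eqP //|no].
have : x * ((x - 1) * (x - 2%:R)) = 0.
  (* In characteristic 3, X^3 - X splits with roots 0, 1, 2. *)
  have -> : x * ((x - 1) * (x - 2%:R)) = x ^+ 3 - x - 3%:R * (x ^+ 2 - x) by ring.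
  by rewrite x3 subrr (pcharf0 ch3) mul0r subr0.
move/eqP; rewrite !mulf_eq0 !subr_eq0 => /or3P[] /eqP e.
- by have := no 0; rewrite emb3_0 e eqxx.
- by have := no 1; rewrite e eqxx.
- by have := no 2%:R; rewrite e eqxx.
Qed.

Lemma horner_cube (p : {poly F}) x : (forall i, p`_i ^+ 3 = p`_i) -> p.[x ^+ 3] = p.[x] ^+ 3.
Proof.
move=> p3; rewrite -!(pFrobenius_autE ch3).
rewrite -[RHS]horner_map; congr _.[_]; apply/polyP => i.
by rewrite coef_map /= pFrobenius_autE.
Qed.

End CharacteristicThree.

Lemma coef_word_poly (F : fieldType) n (c : 'rV['F_3]_n) (i : 'I_n) :
  (word_poly F c)`_i = emb3 F (c ord0 i).
Proof.
rewrite /word_poly coef_sum (bigD1 i) //= coefZ coefXn eqxx mulr1 big1 ?addr0 // => j ji.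
by rewrite coefZ coefXn eq_sym (negPf ji : (j == i :> nat) = false) mulr0.
Qed.

Lemma size_word_poly (F : fieldType) n (c : 'rV['F_3]_n) : (size (word_poly F c) <= n)%N.
Proof.
apply: (leq_trans (size_sum _ _ _)); apply/bigmax_leqP => i _.
by apply: (leq_trans (size_scale_leq _ _)); rewrite size_polyXn.
Qed.

Lemma mem_Tset i1 i2 m j : (0 < m)%N -> (j \in Tset i1 i2 m) =
  [&& (0 < j)%N, (j < 3 ^ m - 1)%N
    & (w3 m j %% 4 == i1 %% 4)%N || (w3 m j %% 4 == i2 %% 4)%N].
Proof.
move=> m0; rewrite mem_filter mem_iota andbC -andbA; congr andb.
have p0 : (3 <= 3 ^ m)%N by rewrite -[X in (X <= _)%N]expn1 leq_pexp2l.
by congr andb; lia.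
Qed.

Lemma uniq_Tset i1 i2 m : uniq (Tset i1 i2 m).
Proof. by rewrite filter_uniq // iota_uniq. Qed.

Lemma size_Tset_lt i1 i2 m : (0 < m)%N -> (size (Tset i1 i2 m) < 3 ^ m - 1)%N.
Proof.
move=> m0; rewrite size_filter; apply: leq_ltn_trans (count_size _ _) _; rewrite size_iota.
have p0 : (3 <= 3 ^ m)%N by rewrite -[X in (X <= _)%N]expn1 leq_pexp2l.
by lia.
Qed.

Section DualCode.
Variables (m i1 i2 : nat) (F : fieldType) (alpha : F).
Hypotheses (m0 : (0 < m)%N) (ch3 : 3%N \in [pchar F]).
Hypothesis prim : (3 ^ m - 1).-primitive_root alpha.
Let n := (3 ^ m - 1)%N.
Let T := Tset i1 i2 m.
Let g := gen_poly alpha i1 i2 m.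

Lemma gen_poly_monic : g \is monic. Proof. exact: monic_prod_XsubC. Qed.

Lemma size_gen_poly : size g = (size T).+1. Proof. exact: size_prod_XsubC. Qed.

(** Tripling modulo n keeps the digit sum, and it is injective because Frobenius is injective on the
    powers of alpha. *)
Lemma rotate_Tset : perm_eq [seq ((3 * j) %% n)%N | j <- T] T.
Proof.
have uM : uniq [seq ((3 * j) %% n)%N | j <- T].
  rewrite map_inj_in_uniq ?uniq_Tset // => j k.
  rewrite !mem_Tset // => /and3P[_ ltj _] /and3P[_ ltk _].
  move=> /eqP; rewrite -(eq_prim_root_expr prim) ![(3 * _)%N]mulnC !exprM.
  rewrite -!(pFrobenius_autE ch3) => /eqP/(fmorph_inj (pFrobenius_aut ch3))/eqP.
  by rewrite (eq_prim_root_expr prim) !modn_small // => /eqP.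
apply: uniq_perm (uniq_Tset _ _ _) _ => //.
apply: (uniq_min_size uM _ _).2; last by rewrite size_map.
move=> _ /mapP[j Tj ->]; move: Tj; rewrite !mem_Tset // => /and3P[j0 ltj wj].
rewrite w3_rotate // wj ltn_mod (leq_ltn_trans _ ltj) // !andbT.
(* The residue is nonzero: 3 is prime to n, so n | 3j would force n | j. *)
rewrite lt0n; apply/negP => dv; move: ltj; rewrite ltnNge dvdn_leq //.
rewrite -(@Gauss_dvdr n 3) //.
have -> : n = (3 * 3 ^ m.-1 - 1)%N by rewrite /n -expnS prednK.
have : (0 < 3 ^ m.-1)%N by rewrite expn_gt0.
case: (3 ^ m.-1)%N => // k _.
have -> : (3 * k.+1 - 1 = k * 3 + 2)%N by lia.
by rewrite coprime_sym -coprime_modr modnMDl.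
Qed.

(** Frobenius permutes the linear factors of g, so the coefficients lie in the prime field. *)
Lemma gen_poly_cube i : g`_i ^+ 3 = g`_i.
Proof.
suff e : map_poly (pFrobenius_aut ch3) g = g.
  by rewrite -{2}e coef_map /= pFrobenius_autE.
rewrite /g /gen_poly rmorph_prod /=.
rewrite -[in RHS](perm_big _ rotate_Tset) big_map; apply: eq_bigr => j _.
rewrite rmorphB /= map_polyX map_polyC /= pFrobenius_autE -exprM mulnC.
by rewrite (prim_expr_mod prim).
Qed.

Definition shift_word s : 'rV['F_3]_n := \row_(i < n) unemb3 (g * 'X^s)`_i.

Lemma shift_wordE s : (s < n - size T)%N -> word_poly F (shift_word s) = g * 'X^s.
Proof.
move=> lt_s; apply/polyP => i; have [lt_i|le_i] := ltnP i n.
  rewrite (coef_word_poly F _ (Ordinal lt_i)) mxE unemb3K //= coefMXn.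
  by case: ltnP => _; rewrite ?expr0n ?gen_poly_cube.
rewrite !nth_default //; last exact: leq_trans (size_word_poly F _) le_i.
apply: leq_trans le_i; rewrite size_monicM ?gen_poly_monic ?monic_neq0 ?monicXn //.
by rewrite size_gen_poly size_polyXn; have := size_Tset_lt i1 i2 m0; rewrite -/T -/n; lia.
Qed.

(** Extends [dotF3] to polynomials over F, since quotients by g are not known to have coefficients
    in the prime field. *)
Definition pairing (c : 'rV['F_3]_n) (f : {poly F}) := \sum_(i < n) emb3 F (c ord0 i) * f`_i.

Lemma pairing_dot c u : pairing c (word_poly F u) = emb3 F (dotF3 c u).
Proof.
rewrite /dotF3 emb3_sum //; apply: eq_bigr => i _.
by rewrite coef_word_poly emb3M.
Qed.

Lemma pairing_mul c (q : {poly F}) : (size q <= n - size T)%N ->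
  (forall s, (s < n - size T)%N -> dotF3 c (shift_word s) = 0) -> pairing c (g * q) = 0.
Proof.
move=> sq orth.
have qE : q = \sum_(s < n - size T) q`_s *: 'X^s.
  rewrite -poly_def; apply/polyP => i; rewrite coef_poly.
  by case: ltnP => // le_i; rewrite nth_default // (leq_trans sq).
transitivity (\sum_(s < n - size T) q`_s * pairing c (g * 'X^s)).
  rewrite {1}/pairing; under [RHS]eq_bigr do rewrite mulr_sumr.
  rewrite exchange_big /=; apply: eq_bigr => i _.
  rewrite {1}qE mulr_sumr coef_sum mulr_sumr; apply: eq_bigr => s _.
  by rewrite -scalerAr coefZ mulrCA.
rewrite big1 // => s _.
by rewrite -shift_wordE // pairing_dot orth // emb3_0 mulr0.
Qed.

Lemma gen_poly_dvd_quotient (f : {poly F}) : (size f <= n)%N -> g %| f ->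
  exists2 q, f = g * q & (size q <= n - size T)%N.
Proof.
move=> sf /dvdpP[q fE]; exists q; first by rewrite mulrC.
have [->|q0] := eqVneq q 0; first by rewrite size_poly0.
by move: sf; rewrite fE size_Mmonic ?gen_poly_monic // size_gen_poly addnS /=; lia.
Qed.

(** Codewords are the multiples g q with deg q < n - |T|, so the shifts of g suffice as tests. *)
Lemma mem_dual_code c : c \in dual_code (cyc_code alpha i1 i2 m) <->
  forall s, (s < n - size T)%N -> dotF3 c (shift_word s) = 0.
Proof.
rewrite inE; split=> [/forall_inP orth s lt_s|orth].
  by apply/eqP/orth; rewrite inE shift_wordE // dvdp_mulr.
apply/forall_inP => u; rewrite inE => dv.
have [q uE sq] := gen_poly_dvd_quotient (size_word_poly F u) dv.
by rewrite -(emb3_eq0 ch3) -pairing_dot uE pairing_mul.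
Qed.

(* Orthogonality to the multiple \sum_i alpha^(k i) X^i of the generator polynomial is
   the vanishing at alpha^k. *)
Lemma dual_code_root c k : c \in dual_code (cyc_code alpha i1 i2 m) ->
  {in T, forall j, ~~ (n %| k + j)%N} -> (word_poly F c).[alpha ^+ k] = 0.
Proof.
move=> /mem_dual_code orth ndv.
pose f := \poly_(i < n) alpha ^+ (k * i).
have dv : g %| f.
  rewrite /g /gen_poly -(big_map (fun j => alpha ^+ j) xpredT (fun z => 'X - z%:P)).
  apply: uniq_roots_dvdp; last first.
    rewrite uniq_rootsE map_inj_in_uniq ?uniq_Tset // => j j'.
    rewrite !mem_Tset // => /and3P[_ ltj _] /and3P[_ ltk _] /eqP.
    by rewrite (eq_prim_root_expr prim) !modn_small // => /eqP.
  apply/allP => _ /mapP[j Tj ->]; apply/rootP.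
  rewrite /f horner_poly.
  (* The geometric sum of an n-th root of unity other than 1 vanishes. *)
  have nz : alpha ^+ (k + j) - 1 != 0.
    by rewrite subr_eq0 -(prim_order_dvd prim) ndv.
  have : (alpha ^+ (k + j)) ^+ n - 1 = 0.
    by rewrite exprAC (prim_expr_order prim) expr1n subrr.
  rewrite subrX1 => e; apply: (mulfI nz); rewrite mulr0 -[RHS]e.
  by congr (_ * _); apply: eq_bigr => i _; rewrite -!exprM -exprD mulnDl.
have [q fE sq] := gen_poly_dvd_quotient (size_poly _ _) dv.
have := pairing_mul sq orth; rewrite -fE /pairing => e; rewrite -[RHS]e.
rewrite (horner_coef_wide _ (size_word_poly F c)).
by apply: eq_bigr => i _; rewrite coef_word_poly coef_poly ltn_ord exprM.
Qed.

(** The dual is the kernel of the transpose of the n - |T| independent shifts of g; rank-nullity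
    gives |T|. *)
Lemma code_dim_dual_code : code_dim (dual_code (cyc_code alpha i1 i2 m)) = size T.
Proof.
pose G : 'M['F_3]_(n - size T, n) := \matrix_(s < n - size T) shift_word s.
have dotG (c : 'rV_n) s : (c *m G^T) 0 s = dotF3 c (shift_word s).
  by rewrite mxE; apply: eq_bigr => i _; rewrite !mxE.
have memD c : (c \in dual_code (cyc_code alpha i1 i2 m)) = (c *m G^T == 0).
  apply/idP/eqP => [/mem_dual_code orth|cG].
    by apply/rowP => s; rewrite dotG orth // mxE.
  by apply/mem_dual_code => s lt_s; rewrite -(dotG c (Ordinal lt_s)) cG mxE.
have freeG : row_free G.
  apply: inj_row_free => v vG; apply/rowP => s; rewrite mxE.
  (* A relation among the rows reads g q = 0, with the coefficients of the relation in q. *)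
  pose q := \poly_(s < n - size T) emb3 F (odflt 0 (omap (v 0) (insub s))).
  have qE (j : 'I_(n - size T)) : q`_j = emb3 F (v 0 j).
    by rewrite coef_poly ltn_ord valK.
  apply/eqP; rewrite -(emb3_eq0 ch3) -qE; apply/eqP.
  suff -> : q = 0 by rewrite coef0.
  have g0 : g != 0 by rewrite monic_neq0 ?gen_poly_monic.
  apply: (mulfI g0); rewrite mulr0.
  have -> : q = \sum_(j < n - size T) emb3 F (v 0 j) *: 'X^j.
    by rewrite /q poly_def; apply: eq_bigr => j _; rewrite valK.
  apply/polyP => i; rewrite coef0 mulr_sumr coef_sum.
  under eq_bigr => j _ do rewrite -scalerAr coefZ -shift_wordE //.
  have [lt_i|le_i] := ltnP i n; last first.
    by rewrite big1 // => j _; rewrite nth_default ?mulr0 // (leq_trans (size_word_poly F _)).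
  have /rowP/(_ (Ordinal lt_i)) := vG; rewrite !mxE => /(congr1 (emb3 F)).
  rewrite emb3_0 emb3_sum // => e; rewrite -[RHS]e; apply: eq_bigr => j _.
  by rewrite emb3M // (coef_word_poly F _ (Ordinal lt_i)) !mxE.
pose phi := linfun (mulmxr G^T) : 'Hom('rV['F_3]_n, 'rV['F_3]_(n - size T)).
have -> : code_dim (dual_code (cyc_code alpha i1 i2 m)) = \dim (lker phi).
  rewrite /code_dim; congr (\dim _); apply/eqP; rewrite eqEsubv; apply/andP; split.
    by apply/span_subvP => c; rewrite mem_enum memD memv_ker lfunE.
  apply/subvP => c; rewrite memv_ker lfunE /= -memD -mem_enum; exact: memv_span.
have := limg_ker_dim phi fullv; rewrite capfv.
have -> : (phi @: fullv = fullv)%VS.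
  apply/eqP; rewrite eqEsubv subvf; apply/subvP => w _.
  have fullG : row_full G^T by rewrite /row_full mxrank_tr -/(row_free G).
  have -> : w = phi (w *m pinvmx G^T) by rewrite lfunE /= mulmxKpV // submx_full.
  by rewrite memv_img ?memvf.
rewrite !dimvf /dim /= !mul1n; have := size_Tset_lt i1 i2 m0; rewrite -/T -/n; lia.
Qed.

End DualCode.

(** * The dual of C_(0,3,m) *)

(** An obstruction would be j = n - k, of digit sum 2m - w3(k); for odd m this is 2 or 1 modulo 4,
    outside {0, 3}. *)
Lemma dual03_root m (F : fieldType) (alpha : F) c k :
  odd m -> 3%N \in [pchar F] -> (3 ^ m - 1).-primitive_root alpha ->
  c \in dual_code (cyc_code alpha 0 3 m) -> (k < 3 ^ m - 1)%N -> (w3 m k %% 4 < 2)%N ->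
  (word_poly F c).[alpha ^+ k] = 0.
Proof.
move=> om ch3 prim Dc ltk wk; have m0 : (0 < m)%N by case: (m) om.
apply: dual_code_root Dc _ => // j; rewrite mem_Tset // => /and3P[j0 ltj wj].
apply/negP => /dvdnP[q e].
have ej : j = (3 ^ m - 1 - k)%N.
  move: (3 ^ m - 1)%N ltk ltj e => n ltk ltj; case: q => [|[|q]]; rewrite ?mulSn; first lia.
    by lia.
  by move: (q * n)%N => p; lia.
have ltk3 : (k < 3 ^ m)%N by lia.
have := w3_le m k; move: wj; rewrite ej w3_compl // => H1 H2; lia.
Qed.

Lemma wt_hweight (F : fieldType) n (c : 'rV['F_3]_n) : 3%N \in [pchar F] ->
  wt c = hweight n (word_poly F c).
Proof.
move=> ch3; rewrite hweightE /wt; congr #|pred_of_set _|.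
by apply/setP => i; rewrite !inE coef_word_poly emb3_eq0.
Qed.

Lemma word_poly_neq0 (F : fieldType) n (c : 'rV['F_3]_n) : 3%N \in [pchar F] ->
  c != 0 -> word_poly F c != 0.
Proof.
move=> ch3; apply: contra => /eqP f0; apply/eqP/rowP => i; rewrite mxE.
by apply/eqP; rewrite -(emb3_eq0 ch3) -coef_word_poly f0 coef0.
Qed.

Lemma word_poly_cube (F : fieldType) n (c : 'rV['F_3]_n) i : 3%N \in [pchar F] ->
  (word_poly F c)`_i ^+ 3 = (word_poly F c)`_i.
Proof.
move=> ch3; have [lt_i|le_i] := ltnP i n.
  by rewrite (coef_word_poly F c (Ordinal lt_i)) emb3_cube.
by rewrite nth_default ?expr0n // (leq_trans (size_word_poly F c)).
Qed.

(** The listed exponents are those below 26 with digit sum 0 or 1 modulo 4. Folding alone would give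
    only weight 5 here. *)
Lemma hweight_dual03_length26 (F : fieldType) (alpha : F) (f : {poly F}) :
  3%N \in [pchar F] -> 26.-primitive_root alpha -> (size f <= 26)%N -> f != 0 ->
  (forall i, f`_i ^+ 3 = f`_i) ->
  {in [:: 0; 1; 3; 8; 9; 14; 16; 17; 20; 22; 23; 24; 25]%N, forall j, f.[alpha ^+ j] = 0} ->
  (8 <= hweight 26 f)%N.
Proof.
move=> ch3 prim sf f0 f3 zf.
(* A zero at alpha^2 completes the run 22, ..., 25, 0, ..., 3 of eight exponents. *)
have [f2|f2] := eqVneq f.[alpha ^+ 2] 0.
  apply: ltnW; apply: (@horner_bch _ _ alpha f 22) => // a lt_a.
  rewrite -(prim_expr_mod prim).
  by case: a lt_a => [|[|[|[|[|[|[|[|]]]]]]]] // _; (exact: zf || exact: f2).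
have f6 : f.[alpha ^+ 6] != 0.
  by rewrite -[6%N]/(2 * 3)%N exprM horner_cube // expf_neq0.
have f18 : f.[alpha ^+ 18] != 0.
  by rewrite -[18%N]/(6 * 3)%N exprM horner_cube // expf_neq0.
have step t b A : free_exps 26 alpha f A ->
    all (mem [:: 0; 1; 3; 8; 9; 14; 16; 17; 20; 22; 23; 24; 25]%N)
      [seq (a + t) %% 26 | a <- A]%N ->
    f.[alpha ^+ b] != 0 -> free_exps 26 alpha f (b :: [seq (a + t) %% 26 | a <- A]%N).
  move=> freeA /allP ZA nzb; apply: free_exps_cons => //; first exact: free_exps_shift.
  by move=> a /ZA; apply: zf.
(* If f(alpha^2) <> 0, all of the conjugate exponents 2, 6, 18 are non-roots; each step
   moves the free set into the root set and adjoins one of them. *)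
have s1 := step 0%N 2%N _ (@free_exps_nil F 26%N alpha f) isT f2.
have s2 := step 25%N 2%N _ s1 isT f2.
have s3 := step 7%N 6%N _ s2 isT f6.
have s4 := step 18%N 18%N _ s3 isT f18.
have s5 := step 16%N 18%N _ s4 isT f18.
have s6 := step 6%N 6%N _ s5 isT f6.
have s7 := step 2%N 2%N _ s6 isT f2.
have s8 := step 1%N 2%N _ s7 isT f2.
exact: (free_exps_le _ s8).
Qed.

(** Used with P = 3^h when g = h: N is 1 modulo u. *)
Lemma coprime_half_pred P u N : (0 < P)%N -> (2 * u = P - 1)%N ->
  (N + N = 3 * (P * P) - 1)%N -> coprime u N.
Proof.
move=> P0 uP NP; have PE : P = (2 * u).+1 by lia.
have -> : (N = 6 * u.+1 * u + 1)%N by move: NP; rewrite PE; lia.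
by rewrite /coprime gcdnMDl gcdn1.
Qed.

(** Used with P = 3^h when g = h + 1: here u divides 3N + 1. *)
Lemma coprime_half_pred3 P u N : (0 < P)%N -> (2 * u = 3 * P - 1)%N ->
  (N + N = 3 * (P * P) - 1)%N -> coprime u N.
Proof.
move=> P0 uP NP.
have E : (2 * u.+1 * u = 3 * N + 1)%N.
  have PE : (3 * P = (2 * u).+1)%N by lia.
  have PP0 : (0 < P * P)%N by rewrite muln_gt0 P0.
  have : (3 * (N + N) + 3 = (3 * P) * (3 * P))%N by rewrite NP; lia.
  by rewrite PE; lia.
have : coprime (2 * u.+1 * u) N by rewrite E coprime_sym /coprime gcdnMDl gcdn1.
by rewrite coprimeMl => /andP[].
Qed.

(** The first bound uses a = 0, ..., 3^h, and [h == 2] accounts for a = 10; the second uses a = 0,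
    ..., 2 3^(h-1). *)
Lemma hweight_dual03 h (F : fieldType) (alpha : F) (f : {poly F}) :
  (0 < h)%N -> (3 ^ (2 * h).+1 - 1).-primitive_root alpha ->
  (size f <= 3 ^ (2 * h).+1 - 1)%N -> f != 0 ->
  (forall k, (k < 3 ^ (2 * h).+1 - 1)%N -> (w3 (2 * h).+1 k %% 4 < 2)%N ->
     f.[alpha ^+ k] = 0) ->
  (3 ^ h + 1 + (h == 2) < hweight (3 ^ (2 * h).+1 - 1) f)%N \/
  (2 * (2 * 3 ^ h.-1 + 2) <= hweight (3 ^ (2 * h).+1 - 1) f)%N.
Proof.
move=> h0 + + f0 zf.
(* Rounding h up to an even number makes 2g divisible by 4. *)
pose g := (h + odd h)%N.
have hg : g = h \/ g = h.+1 by rewrite /g; case: (odd h); rewrite ?addn0 ?addn1; [right|left].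
have even_g : ~~ odd g by rewrite oddD oddb addbb.
have P0 : (0 < 3 ^ h.-1)%N by rewrite expn_gt0.
have Eh : (3 ^ h = 3 * 3 ^ h.-1)%N by rewrite -expnS prednK.
have E2 : (3 ^ (2 * h) = 3 ^ h * 3 ^ h)%N by rewrite mul2n -addnn expnD.
have En : (3 ^ (2 * h).+1 = 3 * (3 ^ h * 3 ^ h))%N by rewrite expnS E2.
have PP0 : (3 ^ h <= 3 ^ h * 3 ^ h)%N by rewrite leq_pmulr // expn_gt0.
have odd3 k : odd (3 ^ k) by rewrite oddX orbT.
pose N := ((3 ^ (2 * h).+1 - 1) %/ 2)%N.
have NN : (3 ^ (2 * h).+1 - 1 = N + N)%N.
  have := odd3 (2 * h).+1; rewrite /N; move: (3 ^ _)%N => P oP; lia.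
pose u := ((3 ^ g - 1) %/ 2)%N.
have uE : (2 * u = 3 ^ g - 1)%N.
  have := odd3 g; rewrite /u; move: (3 ^ _)%N => P oP; lia.
have Eg : (3 ^ g = 3 ^ h \/ 3 ^ g = 3 * 3 ^ h)%N.
  by case: hg => ->; rewrite ?expnS; [left|right].
have co_u : coprime u N.
  have P0' : (0 < 3 ^ h)%N by rewrite expn_gt0.
  by case: Eg => e; [apply: (@coprime_half_pred (3 ^ h)) | apply: (@coprime_half_pred3 (3 ^ h))];
    rewrite // -?En -?NN ?uE ?e.
have mod4 : (2 * g %% 4 = 0)%N by lia.
have zeroE b : (b < 3 ^ h)%N -> f.[alpha ^+ (b.+1 * (3 ^ g - 1))] = 0.
  move=> lt_b; apply: zf.
    apply: (leq_ltn_trans (leq_mul lt_b (leqnn _))); rewrite En.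
    by case: Eg => ->; rewrite mulnBr muln1 ?[(_ * (3 * _))%N]mulnCA; lia.
  have lt_bg : (b < 3 ^ g)%N by case: Eg => ->; lia.
  rewrite w3_multiple ?mod4 //; first by case: hg => ->; lia.
  case: hg => ->; last by have -> : ((2 * h).+1 - h.+1 = h)%N by lia.
  by have -> : ((2 * h).+1 - h = h.+1)%N; [lia | rewrite expnS; lia].
have zeroO b : (b < 2 * 3 ^ h.-1)%N ->
    f.[alpha ^+ (3 ^ (2 * h) + b.+1 * (3 ^ g - 1))] = 0.
  move=> lt_b; apply: zf.
    apply: (leq_ltn_trans (leq_add (leqnn _) (leq_mul lt_b (leqnn _)))).
    rewrite En E2; case: Eg => ->; rewrite Eh.
      move: (3 ^ h.-1)%N P0 => R R0; have : (R <= R * R)%N by rewrite leq_pmulr.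
      by rewrite mulnBr; clear -R0; lia.
    move: (3 ^ h.-1)%N P0 => R R0; have : (R <= R * R)%N by rewrite leq_pmulr.
    by rewrite mulnBr; clear -R0; lia.
  by rewrite w3_multiple_shift //; lia.
have zero0 : f.[alpha ^+ 0] = 0 by apply: zf; rewrite ?w3_0 // En; lia.
have zero1 : f.[alpha ^+ (3 ^ (2 * h))] = 0.
  apply: zf; first by rewrite En E2; lia.
  by rewrite -[(3 ^ (2 * h))%N]add0n w3_add_pow ?w3_0 // muln_gt0 expn_gt0.
(* Here g = 2 and the exponent is 80, with four digits 2 and digit sum 8. *)
have zero2 : h = 2 -> f.[alpha ^+ (10 * (3 ^ g - 1))] = 0.
  by move=> h2; apply: zf; rewrite /g h2 // /w3 !big_ord_recr big_ord0.
rewrite NN => prim sf.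
have -> : (2 * (2 * 3 ^ h.-1 + 2) = 2 * (2 * 3 ^ h.-1 + 1).+1)%N by lia.
apply: (fold_bound prim sf co_u (odd3 (2 * h)%N) f0) => [|] [|a];
  rewrite uE ?muln0 ?addn0 // [(_ * a.+1)%N]mulnC => lt_a; last by apply: zeroO; lia.
have [lt_a3|] := ltnP a (3 ^ h)%N; first exact: zeroE.
move: lt_a; case: eqP => [h2 lt_a le_a|]; last by lia.
have -> : a = 9%N by rewrite h2 in le_a lt_a; lia.
exact: zero2.
Qed.

Theorem theorem7 (m : nat) (F : finFieldType) (alpha : F) :
  (3 <= m)%N -> odd m -> #|F| = (3 ^ m)%N ->
  (3 ^ m - 1).-primitive_root alpha ->
  let D := dual_code (cyc_code alpha 0 3 m) in
  (* minimum distance bound: every nonzero codeword has weight >= bound *)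
  (forall c, c \in D -> c != 0 ->
     if (m %% 4 == 1)%N then (3 ^ ((m - 1) %/ 2) + 15 <= 2 * wt c)%N
     else (3 ^ ((m - 1) %/ 2) + 13 <= 2 * wt c)%N) /\
  (* dimension *)
  (if (m %% 4 == 1)%N then (2 * code_dim D = (3 ^ m - 1) - 2)%N
   else (2 * code_dim D = 3 ^ m - 1)%N).
Proof.
move=> m3 om cardF prim D.
have ch3 : 3%N \in [pchar F] by apply: (card_finPcharP cardF).
split; last first.
  rewrite code_dim_dual_code ?size_Tset03 //; try by lia.
  by case: eqP.
move=> c Dc c0; rewrite (wt_hweight c ch3).
have f0 := word_poly_neq0 ch3 c0; have sf := size_word_poly F c.
have zf k : (k < 3 ^ m - 1)%N -> (w3 m k %% 4 < 2)%N -> (word_poly F c).[alpha ^+ k] = 0.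
  exact: dual03_root.
have f3 i := word_poly_cube c i ch3.
have [h mE] : exists h, m = (2 * h).+1.
  by exists m./2; rewrite mul2n -[LHS]odd_double_half om.
subst m.
have -> : (((2 * h).+1 - 1) %/ 2 = h)%N by lia.
have [h1|h_neq1] := eqVneq h 1%N.
  subst h; have : (8 <= hweight 26 (word_poly F c))%N.
    apply: (@hweight_dual03_length26 _ alpha) => // j Zj.
    have w3E : w3 3 j = (j %% 3 + (j %/ 3 %% 3 + j %/ 3 %/ 3 %% 3))%N.
      by rewrite !w3S /w3 big_ord0 addn0.
    (* Explicit digits make the condition on the listed exponents decidable by computation. *)
    pose P k := ((k < 26) && ((k %% 3 + (k %/ 3 %% 3 + k %/ 3 %/ 3 %% 3)) %% 4 < 2))%N.
    have /andP[lt_j wj] : P j by apply: allP Zj.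
    by apply: zf; rewrite ?w3E.
  by move=> H /=; move: H; rewrite -[(3 ^ (2 * 1).+1 - 1)%N]/26%N; lia.
have h2 : (1 < h)%N by lia.
have := hweight_dual03 (ltnW h2) prim sf f0 zf; move: (hweight _ _) => W.
have P1 : (3 <= 3 ^ h.-1)%N by rewrite -[X in (X <= _)%N]expn1 leq_pexp2l //; lia.
have Eh : (3 ^ h = 3 * 3 ^ h.-1)%N by rewrite -expnS prednK // ltnW.
(* For h = 2 the bounds are 12 and 16, and the target is 12. *)
have [->|h_neq2] := eqVneq h 2%N; first by move=> /=; lia.
(* With P = 3^(h-1) at least 9, both 3P + 2 and 4P + 4 exceed (3P + 15)/2. *)
have P2 : (3 ^ 2 <= 3 ^ h.-1)%N by rewrite leq_pexp2l //; lia.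
by rewrite Eh; move: (3 ^ h.-1)%N P1 P2 => P P1 P2; case: ifP => _; lia.
Qed.
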